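(* Let $\varepsilon>0$. Suppose that $\Sigma_{\mathrm{pk}}$ is bounded and satisfies $\gamma_{\mathrm{pk}}>0$, where $$\gamma_{\mathrm{pk}}=\inf\bigl\{\sigma_n\bigl(\begin{bmatrix}B & AB & \cdots & A^{n-1}B\end{bmatrix}\bigr)\ \big|\ (A,B)\in\Sigma_{\mathrm{pk}}\bigr\}.$$ Then $\Sigma_{\mathrm{pk}}$ enables universal experiment design for identification if and only if it is uniformly discrete.
   Context: Let $n,m\in\mathbb{N}$, $\varepsilon\ge 0$, and $\Sigma=\mathbb{R}^{n\times n}\times\mathbb{R}^{n\times m}$. $\|\cdot\|$ is the Euclidean norm for vectors and spectral norm for matrices; $\sigma_n(M)$ is the $n$-th largest singular value of $M$. A signal $u(0),\dots,u(T-1)\in\mathbb{R}^m$ is identified with the stacked vector $u_{[0,T-1]}\in\mathbb{R}^{mT}$; similarly for $x_{[0,T]}$. For $T\in\mathbb{N}$ and $(A,B)\in\Sigma$, $\mathfrak{B}_T(A,B)$ is the set of all pairs $(u_{[0,T-1]},x_{[0,T]})$, with $u(t)\in\mathbb{R}^m$, $x(t)\in\mathbb{R}^n$, for which there exist $w(0),\dots,w(T-1)\in\mathbb{R}^n$ with $\|w(t)\|\le\varepsilon$ and $x(t+1)=Ax(t)+Bu(t)+w(t)$ for $t=0,\dots,T-1$. $\mathfrak{B}(A,B,u_{[0,T-1]})$ is the set of those elements of $\mathfrak{B}_T(A,B)$ whose input part equals the given $u_{[0,T-1]}$. For a dataset $\mathcal{D}$, $\Sigma_{\mathcal{D}}=\{(A,B)\in\Sigma\mid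 \mathcal{D}\in\mathfrak{B}_T(A,B)\}$. $\Sigma_{\mathrm{pk}}\subseteq\Sigma$ is the prior knowledge set (it contains the unknown true system, hence is nonempty), and $\Sigma_{\mathrm{pk}}-\Sigma_{\mathrm{pk}}$ is the set of all differences of two of its elements. $\Sigma_{\mathrm{pk}}$ is uniformly discrete if $\delta_{\mathrm{pk}}>0$, where $\delta_{\mathrm{pk}}=\inf\{\|[F\ \ G]\|\neq 0\mid (F,G)\in\Sigma_{\mathrm{pk}}-\Sigma_{\mathrm{pk}}\}$ (with $\inf\emptyset=+\infty$). A dataset $\mathcal{D}\in\mathfrak{B}_T(A,B)$ with $(A,B)\in\Sigma_{\mathrm{pk}}$ is $\Sigma_{\mathrm{pk}}$-informative for identification if $\Sigma_{\mathcal{D}}\cap\Sigma_{\mathrm{pk}}$ is a singleton. An input $u_{[0,T-1]}$ is $\Sigma_{\mathrm{pk}}$-universal for identification if every $\mathcal{D}\in\bigcup_{(A,B)\in\Sigma_{\mathrm{pk}}}\mathfrak{B}(A,B,u_{[0,T-1]})$ is $\Sigma_{\mathrm{pk}}$-informative for identification. $\Sigma_{\mathrm{pk}}$ enables universal experiment design for identification if there exist $T\in\mathbb{N}$ and an input $u_{[0,T-1]}\in\mathbb{R}^{mT}$ that is $\Sigma_{\mathrm{pk}}$-universal for identification. *)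

(* Defs.v *)
From mathcomp Require Import all_boot all_order all_algebra.
From mathcomp Require Import polyrcf.
From mathcomp Require Import all_classical all_reals all_analysis.
Set Implicit Arguments.
Unset Strict Implicit.
Unset Printing Implicit Defensive.
Import Order.TTheory GRing.Theory Num.Theory.
Import numFieldNormedType.Exports.
Local Open Scope classical_set_scope.
Local Open Scope ring_scope.

Definition euclid_norm (R : realType) (p : nat) (v : 'cV[R]_p) : R :=
  Num.sqrt (\sum_i v i 0 ^+ 2).

Definition spectral_norm (R : realType) (p q : nat) (M : 'M[R]_(p, q)) : R :=
  sup [set euclid_norm (M *m v) | v in [set v : 'cV[R]_q | euclid_norm v <= 1]].

(* Eigenvalues of M M^T with multiplicity; [rootsR] lists each root once.
   If p > q this contains p - q zeros beyond the usual min(p, q) values. *)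
Definition singular_values (R : realType) (p q : nat) (M : 'M[R]_(p, q)) :
    seq R :=
  let chi := char_poly (M *m M^T) in
  sort >=%R (flatten [seq nseq (mup x chi) (Num.sqrt x) | x <- rootsR chi]).

(* The k-th largest singular value, counted from k = 1. *)
Definition sigma_ (R : realType) (p q : nat) (k : nat) (M : 'M[R]_(p, q)) : R :=
  nth 0 (singular_values M) k.-1.

Definition system (R : realType) (n m : nat) : Type :=
  ('M[R]_n * 'M[R]_(n, m))%type.

(* An input u(0), ..., u(T-1) together with a state sequence x(0), ..., x(T). *)
Definition dataset (R : realType) (n m T : nat) : Type :=
  (('I_T -> 'cV[R]_m) * ('I_T.+1 -> 'cV[R]_n))%type.

(* [widen_ord _ t] and [lift ord0 t] are t and t + 1 as indices in 'I_T.+1. *)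
Definition behavior (R : realType) (n m : nat) (eps : R) (T : nat)
    (S : system R n m) : set (dataset R n m T) :=
  [set D | exists w : 'I_T -> 'cV[R]_n, forall t : 'I_T,
     euclid_norm (w t) <= eps /\
     D.2 (lift ord0 t) =
       S.1 *m D.2 (widen_ord (leqnSn T) t) + S.2 *m D.1 t + w t].

Definition behavior_input (R : realType) (n m : nat) (eps : R) (T : nat)
    (S : system R n m) (u : 'I_T -> 'cV[R]_m) : set (dataset R n m T) :=
  [set D | behavior eps S D /\ D.1 = u].

Definition consistent (R : realType) (n m : nat) (eps : R) (T : nat)
    (D : dataset R n m T) : set (system R n m) :=
  [set S | behavior eps S D].

Definition informative (R : realType) (n m : nat) (eps : R)
    (Spk : set (system R n m)) (T : nat) (D : dataset R n m T) : Prop :=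
  exists S : system R n m, consistent eps D `&` Spk = [set S].

Definition universal_input (R : realType) (n m : nat) (eps : R)
    (Spk : set (system R n m)) (T : nat) (u : 'I_T -> 'cV[R]_m) : Prop :=
  \bigcup_(S in Spk) behavior_input eps S u `<=`
    [set D | informative eps Spk D].

Definition enables_universal_design (R : realType) (n m : nat) (eps : R)
    (Spk : set (system R n m)) : Prop :=
  exists (T : nat) (u : 'I_T -> 'cV[R]_m), universal_input eps Spk u.

Definition system_norm (R : realType) (n m : nat) (S : system R n m) : R :=
  spectral_norm (row_mx S.1 S.2).

Definition differences (R : realType) (n m : nat) (Spk : set (system R n m)) :
    set (system R n m) :=
  [set (S1.1 - S2.1, S1.2 - S2.2) | S1 in Spk & S2 in Spk].

(* The infimum is taken in \bar R, so it is +oo when there is no nonzero norm. *)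
Definition delta_pk (R : realType) (n m : nat) (Spk : set (system R n m)) :
    \bar R :=
  ereal_inf [set r%:E | r in (@system_norm R n m @` differences Spk) `\ 0].

Definition uniformly_discrete (R : realType) (n m : nat)
    (Spk : set (system R n m)) : Prop :=
  (0 < delta_pk Spk)%E.

Definition bounded_systems (R : realType) (n m : nat)
    (Spk : set (system R n m)) : Prop :=
  [bounded system_norm S | S in Spk].

Definition controllability_mx (R : realType) (n m : nat) (S : system R n m) :
    'M[R]_(n, \sum_(k < n) m) :=
  \mxrow_(k < n) (S.1 ^+ k *m S.2).

Definition gamma_pk (R : realType) (n m : nat) (Spk : set (system R n m)) :
    \bar R :=
  ereal_inf [set (sigma_ n (controllability_mx S))%:E | S in Spk].

(* Main.v *)
Require Import Defs.
From mathcomp Require Import all_boot all_order all_algebra.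
From mathcomp Require Import polyrcf zify ring lra.
From mathcomp Require Import all_classical all_reals all_analysis.
Import Order.TTheory GRing.Theory Num.Theory.
Local Open Scope classical_set_scope.
Local Open Scope ring_scope.

(** Universality forces discreteness because of the noise. If [Spk] is not
    uniformly discrete, it contains distinct systems S1 and S2 whose difference
    (F, G) is as small as desired. For a fixed input, the noise-free
    trajectories of the systems of [Spk] that start at the origin are bounded
    uniformly, since [Spk] is bounded. The trajectory of S1 is then also one of
    S2 with noise F x(t) + G u(t), whose norm is at most [eps], so the two
    systems cannot be told apart ([enables_uniformly_discrete]).

    Conversely, a bounded and uniformly discrete set is finite
    ([bounded_discrete_finite]), so it is enough to find an input family that
    separates any given pair of systems as soon as its amplitude alpha is large
    enough ([impulse_train_separates]); finitely many thresholds have a common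
    upper bound. If a dataset is consistent with both S1 and S2, then
    y(t) = F x(t) + G u(t) is bounded by 2 eps at all times. Fix a row (xi, eta)
    of (F, G) that is not zero, and filter the scalar signal
    xi x(t) + eta u(t) by the characteristic polynomial p of A, the state matrix
    of S1. By the Cayley-Hamilton theorem the contribution of the unknown state
    at the start of the window vanishes ([filtered_output]), and what remains is
    a fixed linear combination sum_j z_j u(t + j) of the inputs plus a bounded
    noise term.

    The coefficients z_j are triangular in eta, xi B, xi A B, ... with unit
    diagonal because p is monic, so they cannot all vanish when S1 is
    controllable ([input_coef_eq0], [left_controllable_eq0]); controllability is
    what the bound on the singular values gives
    ([sigma_gt0_left_injective]). Hence z_j has a nonzero entry i for some j.
    The input [impulse_train] applies impulses alpha e_i one after the other, so
    far apart that some window contains the impulse alpha e_i alone, at position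
    j. In that window alpha |z_j(i)| is bounded by a constant that depends only
    on the pair, which fails for large alpha. *)

(** * Euclidean and spectral norms *)

Lemma normr_le_euclid_norm {R : realType} {p : nat} (v : 'cV[R]_p) i :
  `|v i 0| <= euclid_norm v.
Proof.
rewrite -sqrtr_sqr /euclid_norm ler_sqrt; last first.
  by apply: sumr_ge0 => k _; exact: sqr_ge0.
rewrite (bigD1 i) //= lerDl; apply: sumr_ge0 => k _; exact: sqr_ge0.
Qed.

Lemma euclid_norm_le_sum {R : realType} {p : nat} (v : 'cV[R]_p) :
  euclid_norm v <= \sum_i `|v i 0|.
Proof.
have s0 : 0 <= \sum_i `|v i 0| by apply: sumr_ge0.
rewrite -(ger0_norm s0) -sqrtr_sqr ler_sqrt ?sqr_ge0 // expr2 mulr_suml.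
apply: ler_sum => i _.
rewrite -[v i 0 ^+ 2]ger0_norm ?sqr_ge0 // expr2 normrM ler_wpM2l //.
by rewrite (bigD1 i) //= lerDl sumr_ge0.
Qed.

Lemma normr_mulmx_le {R : realType} {p q : nat} (c z : R) (M : 'M[R]_(p, q))
    (v : 'cV[R]_q) :
  (forall i j, `|M i j| <= c) -> (forall j, `|v j 0| <= z) ->
  forall i, `|(M *m v) i 0| <= q%:R * (c * z).
Proof.
move=> Mc vz i; rewrite mxE (le_trans (ler_norm_sum _ _ _)) //.
rewrite -[q in q%:R]card_ord -sum1_card natr_sum mulr_suml ler_sum // => j _.
by rewrite normrM mul1r ler_pM.
Qed.

Lemma euclid_norm_mulmx_le {R : realType} {p q : nat} (M : 'M[R]_(p, q))
    (v : 'cV[R]_q) :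
  euclid_norm v <= 1 -> euclid_norm (M *m v) <= \sum_i \sum_j `|M i j|.
Proof.
move=> v1; apply: le_trans (euclid_norm_le_sum _) _.
apply: ler_sum => i _; rewrite mxE; apply: le_trans (ler_norm_sum _ _ _) _.
apply: ler_sum => j _; rewrite normrM ler_piMr //.
exact: le_trans (normr_le_euclid_norm v j) v1.
Qed.

Lemma euclid_norm0 {R : realType} {p : nat} : euclid_norm (0 : 'cV[R]_p) = 0.
Proof.
by rewrite /euclid_norm big1 ?sqrtr0 // => i _; rewrite mxE expr0n.
Qed.

(** With [normr_le_spectral_norm], this makes smallness and boundedness in
    spectral norm equivalent to the same properties of the entries. *)
Lemma spectral_norm_le_sum {R : realType} {p q : nat} (M : 'M[R]_(p, q)) :
  spectral_norm M <= \sum_i \sum_j `|M i j|.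
Proof.
apply: ge_sup => [|_ [v /= v1 <-]]; last exact: euclid_norm_mulmx_le.
by exists (euclid_norm (M *m 0)); exists 0; rewrite //= euclid_norm0.
Qed.

Lemma euclid_norm_le_spectral_norm {R : realType} {p q : nat}
    (M : 'M[R]_(p, q)) (v : 'cV[R]_q) :
  euclid_norm v <= 1 -> euclid_norm (M *m v) <= spectral_norm M.
Proof.
move=> v1; apply: ub_le_sup; last by exists v.
exists (\sum_i \sum_j `|M i j|) => _ [y /= y1 <-].
exact: euclid_norm_mulmx_le.
Qed.

Lemma normr_le_spectral_norm {R : realType} {p q : nat} (M : 'M[R]_(p, q)) i j :
  `|M i j| <= spectral_norm M.
Proof.
have -> : M i j = (M *m (delta_mx j 0 : 'cV_q)) i 0 by rewrite -colE mxE.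
apply: le_trans (normr_le_euclid_norm _ _) _.
apply: euclid_norm_le_spectral_norm; rewrite /euclid_norm (bigD1 j) //= big1.
  by rewrite mxE !eqxx expr1n addr0 sqrtr1.
by move=> k /negbTE kj; rewrite mxE kj expr0n.
Qed.

Lemma spectral_norm0 {R : realType} {p q : nat} :
  spectral_norm (0 : 'M[R]_(p, q)) = 0.
Proof.
apply/eqP; rewrite eq_le; apply/andP; split.
  apply: le_trans (spectral_norm_le_sum _) _.
  by rewrite big1 // => i _; rewrite big1 // => j _; rewrite mxE normr0.
rewrite -[leLHS](@euclid_norm0 R p) -[X in euclid_norm X](mul0mx _ (0 : 'cV_q)).
by apply: euclid_norm_le_spectral_norm; rewrite euclid_norm0.
Qed.

(** * Controllability from singular values *)

(** The powers of the distinct factors X - x divide p jointly; they are split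
    off one at a time, which leaves the other multiplicities unchanged. *)
Lemma sum_mup_lt_size {R : fieldType} (r : seq R) (p : {poly R}) :
  uniq r -> p != 0 -> (\sum_(x <- r) mup x p < size p)%N.
Proof.
elim: r p => [|a r IHr] p /= => [_ p0|/andP[ar ur] p0].
  by rewrite big_nil size_poly_gt0.
rewrite big_cons; set k := mup a p.
have /dvdpP[q pE] : ('X - a%:P) ^+ k %| p by rewrite -mup_geq.
have q0 : q != 0 by apply: contra_neq p0 => q0; rewrite pE q0 mul0r.
have -> : size p = (k + size q)%N.
  rewrite pE size_Mmonic ?monic_exp ?monicXsubC // size_exp_XsubC addnC.
  by rewrite addSn.
rewrite ltn_add2l (leq_ltn_trans _ (IHr q ur q0)) //.
rewrite leq_eqVlt; apply/orP; left; apply/eqP; apply: eq_big_seq => x xr.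
rewrite pE mupMl // rootE horner_exp hornerXsubC expf_eq0 subr_eq0.
by apply: contraNN ar => /andP[_ /eqP <-].
Qed.

Lemma size_singular_values {R : realType} {p q : nat} (M : 'M[R]_(p, q)) :
  (size (singular_values M) <= p)%N.
Proof.
rewrite /singular_values; set chi := char_poly _.
have chi0 : chi != 0 by rewrite monic_neq0 ?char_poly_monic.
rewrite size_sort size_flatten /shape -map_comp sumnE big_map.
under eq_bigr => x _ do rewrite /= size_nseq.
by rewrite -ltnS -(size_char_poly (M *m M^T)) sum_mup_lt_size ?uniq_roots.
Qed.

(** If v is a nonzero left kernel vector of M, then 0 is an eigenvalue of
    M M^T, so 0 occurs in the list of singular values. That list is decreasing
    and has at most p entries, so its p-th entry is at most 0. *)
Lemma sigma_gt0_left_injective {R : realType} {p q : nat} (M : 'M[R]_(p, q))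
    (v : 'rV[R]_p) :
  0 < sigma_ p M -> v *m M = 0 -> v = 0.
Proof.
move=> sgt vM; apply/eqP; apply: contraTT sgt => v0; rewrite -leNgt /sigma_.
set s := singular_values M.
(* Beyond the end of the list, [sigma_] takes the default value 0. *)
have [sp|ps] := leqP (size s) p.-1; first by rewrite nth_default.
have chi0 : root (char_poly (M *m M^T)) 0.
  rewrite -eigenvalue_root_char; apply/eigenvalueP; exists v => //.
  by rewrite mulmxA vM mul0mx scale0r.
have nz : char_poly (M *m M^T) != 0 by rewrite monic_neq0 ?char_poly_monic.
have s0 : 0 \in s.
  rewrite mem_sort; apply/flattenP.
  exists (nseq (mup 0 (char_poly (M *m M^T))) (Num.sqrt 0)).
    by apply/mapP; exists 0 => //; rewrite -roots_on_rootsR // chi0 andbT.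
  by rewrite mem_nseq sqrtr0 eqxx andbT -XsubC_dvd // dvdp_XsubCl.
have /(nth_index 0) E := s0; rewrite -[X in _ <= X]E.
have s_sorted : sorted >=%R s by apply: sort_sorted => x y; exact: le_total.
have ge_trans : transitive (fun x y : R => y <= x).
  by move=> y x z yx zy; exact: le_trans zy yx.
apply: (sorted_leq_nth ge_trans (@lexx _ R) 0 s_sorted).
- by rewrite inE index_mem.
- by rewrite inE.
- have : (index (0%R : R) s < p)%N.
    by apply: leq_trans (size_singular_values M); rewrite index_mem.
  by case: (p).
Qed.

Lemma left_controllable_eq0 {R : realType} {n m : nat} (S : system R n m)
    (xi : 'rV[R]_n) :
  0 < sigma_ n (controllability_mx S) ->
  (forall k, (k < n)%N -> xi *m S.1 ^+ k *m S.2 = 0) -> xi = 0.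
Proof.
move=> sgt xiS; apply: sigma_gt0_left_injective sgt _.
rewrite mul_mxrow -[RHS]mxrow0; apply: eq_mxrow => k.
by rewrite mulmxA xiS.
Qed.

(** * Cancelling the initial state *)

Lemma char_poly_mx_sum {R : comNzRingType} {n : nat} (A : 'M[R]_n.+1) :
  \sum_(k < n.+2) (char_poly A)`_k *: A ^+ k = 0.
Proof.
rewrite -[RHS](Cayley_Hamilton A) -{2}[char_poly A]coefK poly_def.
rewrite size_char_poly linear_sum; apply: eq_bigr => k _.
by rewrite linearZ /= rmorphXn /= horner_mx_X.
Qed.

(** Variation of constants; v collects the input and the noise. *)
Lemma state_expand {R : comNzRingType} {n : nat} (A : 'M[R]_n.+1) (N : nat)
    (x v : nat -> 'cV[R]_n.+1) :
  (forall k, (k < N)%N -> x k.+1 = A *m x k + v k) ->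
  forall k, (k <= N)%N ->
    x k = A ^+ k *m x 0 + \sum_(j < k) A ^+ (k - j.+1) *m v j.
Proof.
move=> xS; elim=> [|k IHk] kN; first by rewrite expr0 mul1mx big_ord0 addr0.
rewrite xS // IHk ?(ltnW kN) // mulmxDr mulmxA [A ^+ k.+1]exprS -addrA.
congr (_ + _); rewrite big_ord_recr /= subnn expr0 mul1mx; congr (_ + _).
rewrite mulmx_sumr; apply: eq_bigr => j _.
by rewrite mulmxA subSn // exprS.
Qed.

(** The coefficient z_j of u(t + j) that remains when xi x(t) + eta u(t) is
    filtered by the characteristic polynomial of A. *)
Definition input_coef {R : comNzRingType} {n m : nat} (A : 'M[R]_n.+1)
    (B : 'M[R]_(n.+1, m)) (xi : 'rV[R]_n.+1) (eta : 'rV[R]_m) (j : nat) :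
    'rV[R]_m :=
  (char_poly A)`_j *: eta +
  \sum_(k < n.+2 | (j < k)%N)
    (char_poly A)`_k *: (xi *m A ^+ (k - j.+1) *m B).

(** The filtered free response is xi p(A) x(0), which is 0 by Cayley-Hamilton:
    nothing on the right depends on the state. *)
Lemma filtered_output {R : comNzRingType} {n m : nat} (A : 'M[R]_n.+1)
    (B : 'M[R]_(n.+1, m)) (xi : 'rV[R]_n.+1) (eta : 'rV[R]_m)
    (x w : nat -> 'cV[R]_n.+1) (u : nat -> 'cV[R]_m) :
  (forall k, (k < n.+1)%N -> x k.+1 = A *m x k + B *m u k + w k) ->
  \sum_(k < n.+2) (char_poly A)`_k *: (xi *m x k + eta *m u k) =
  \sum_(j < n.+2) input_coef A B xi eta j *m u j +
  \sum_(k < n.+2) (char_poly A)`_k *: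
    (\sum_(j < k) xi *m A ^+ (k - j.+1) *m w j).
Proof.
move=> xS; set p := char_poly A.
have xE (k : 'I_n.+2) : x k = A ^+ k *m x 0
    + \sum_(j < k) A ^+ (k - j.+1) *m (B *m u j + w j).
  apply: (@state_expand _ _ _ n.+1 x (fun i => B *m u i + w i));
    last by rewrite -ltnS.
  by move=> i iN; rewrite xS // addrA.
have free0 : \sum_(k < n.+2) p`_k *: (xi *m (A ^+ k *m x 0)) = 0.
  rewrite -[RHS](mul0mx _ (x 0)) -(mulmx0 _ xi) -(char_poly_mx_sum A).
  rewrite mulmx_sumr mulmx_suml; apply: eq_bigr => k _.
  by rewrite -scalemxAr -scalemxAl mulmxA.
transitivity (\sum_(k < n.+2) p`_k *: (xi *m (A ^+ k *m x 0)) +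
    (\sum_(k < n.+2) (p`_k *: eta) *m u k +
     \sum_(k < n.+2) \sum_(j < n.+2 | (j < k)%N)
        p`_k *: (xi *m A ^+ (k - j.+1) *m B) *m u j +
     \sum_(k < n.+2) p`_k *: (\sum_(j < k) xi *m A ^+ (k - j.+1) *m w j))).
  rewrite -!big_split /=; apply: eq_bigr => k _.
  rewrite xE mulmxDr !scalerDr [_ *: (eta *m _)]scalemxAl -!addrA.
  congr (_ + _); rewrite [LHS]addrC; congr (_ + _).
  rewrite -(big_ord_widen _
    (fun j => p`_k *: (xi *m A ^+ (k - j.+1) *m B) *m u j)); last exact: ltnW.
  under [X in X + _]eq_bigr do rewrite /= -scalemxAl.
  rewrite -scaler_sumr -scalerDr -big_split /= mulmx_sumr; congr (_ *: _).
  by apply: eq_bigr => j _; rewrite mulmxDr mulmxDr !mulmxA.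
rewrite free0 add0r; congr (_ + _).
rewrite (exchange_big_dep xpredT) //= -big_split /=.
by apply: eq_bigr => j _; rewrite /input_coef mulmxDl mulmx_suml.
Qed.

(** As p is monic of degree N = n + 1, z_N is eta, and z_(N-1-k) is
    xi A^k B plus a combination of eta and of the xi A^h B with h < k. *)
Lemma input_coef_eq0 {R : comNzRingType} {n m : nat} (A : 'M[R]_n.+1)
    (B : 'M[R]_(n.+1, m)) (xi : 'rV[R]_n.+1) (eta : 'rV[R]_m) :
  (forall j, (j < n.+2)%N -> input_coef A B xi eta j = 0) ->
  eta = 0 /\ forall k, (k < n.+1)%N -> xi *m A ^+ k *m B = 0.
Proof.
move=> z0.
have pn : (char_poly A)`_n.+1 = 1.
  have := char_poly_monic A; rewrite monicE lead_coefE size_char_poly /=.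
  by move/eqP.
have eta0 : eta = 0.
  rewrite -(z0 n.+1) // /input_coef pn scale1r big1 ?addr0 // => k.
  by rewrite ltnNge -ltnS ltn_ord.
split=> //; elim/ltn_ind => k IHk kn.
have := z0 (n - k)%N; rewrite /input_coef eta0 scaler0 add0r.
rewrite (bigD1 ord_max) /=; last by rewrite ltnS leq_subr.
rewrite pn scale1r subSS subKn // big1 ?addr0 => [->//|].
  by rewrite ltnS (leq_trans (leq_subr _ _)).
move=> i /andP[ki imax]; rewrite IHk ?scaler0 //.
  have : (i < n.+1)%N.
    by rewrite ltn_neqAle -ltnS ltn_ord andbT.
  lia.
have := ltn_ord i; lia.
Qed.

(** The noise and the output bound the filtered output by a constant that
    depends neither on the amplitude alpha nor on the state. *)
Lemma impulse_response_bounded {R : realType} {n m : nat} (A : 'M[R]_n.+1)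
    (B : 'M[R]_(n.+1, m)) (xi : 'rV[R]_n.+1) (eta : 'rV[R]_m) (eps c : R)
    (j : nat) (i : 'I_m) :
  (j < n.+2)%N ->
  exists M : R, forall alpha (x w : nat -> 'cV[R]_n.+1) (u : nat -> 'cV[R]_m),
    (forall k, (k < n.+1)%N -> x k.+1 = A *m x k + B *m u k + w k) ->
    (forall k, (k < n.+2)%N ->
       u k = if k == j then alpha *: delta_mx i 0 else 0) ->
    (forall k l, (k < n.+1)%N -> `|w k l 0| <= eps) ->
    (forall k, (k < n.+2)%N -> `|(xi *m x k + eta *m u k) 0 0| <= c) ->
    `|alpha * input_coef A B xi eta j 0 i| <= M.
Proof.
move=> jn; pose p := char_poly A.
exists (\sum_(k < n.+2) `|p`_k| * c +
        \sum_(k < n.+2) `|p`_k| * \sum_(h < k) \sum_l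
          `|(xi *m A ^+ (k - h.+1)) 0 l| * eps).
move=> alpha x w u xS uE w_le y_le.
have /matrixP/(_ 0 0) := filtered_output A B xi eta x w u xS.
have -> : \sum_(k < n.+2) input_coef A B xi eta k *m u k =
    alpha *: col i (input_coef A B xi eta j).
  rewrite (bigD1 (Ordinal jn)) //= uE // eqxx -scalemxAr -colE big1 ?addr0 //.
  by move=> k /negbTE kj; rewrite uE // -[_ == j]/(k == Ordinal jn) kj mulmx0.
rewrite [RHS]mxE [in RHS]mxE [X in alpha * X]mxE.
move/eqP; rewrite -subr_eq => /eqP <-.
apply: le_trans (ler_normB _ _) _; apply: lerD.
  rewrite summxE; apply: le_trans (ler_norm_sum _ _ _) _.
  by apply: ler_sum => k _; rewrite mxE normrM ler_wpM2l // y_le.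
rewrite summxE; apply: le_trans (ler_norm_sum _ _ _) _.
apply: ler_sum => k _; rewrite mxE normrM ler_wpM2l // summxE.
apply: le_trans (ler_norm_sum _ _ _) _; apply: ler_sum => h _.
rewrite mxE; apply: le_trans (ler_norm_sum _ _ _) _; apply: ler_sum => l _.
rewrite normrM ler_wpM2l // w_le //.
have := ltn_ord h; have := ltn_ord k; lia.
Qed.

(** * Impulse trains *)

(** Time is cut into m blocks of length 2 n + 1, and block l carries the impulse
    alpha e_l in its middle. The windows of length n + 1 around this impulse
    stay inside the block and show it at any position from 0 to n. *)
Definition impulse_train {R : realType} (n m : nat) (alpha : R)
    (t : 'I_(m * n.*2.+1)) : 'cV[R]_m :=
  \col_l (if (t %/ n.*2.+1 == l)%N && (t %% n.*2.+1 == n)%N then alpha else 0).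

Lemma impulse_train_window {R : realType} {n m : nat} (alpha : R) (i : 'I_m)
    (j k : nat) (t : 'I_(m * n.*2.+1)) :
  (j <= n)%N -> (k <= n)%N -> t = (i * n.*2.+1 + (n - j) + k)%N :> nat ->
  impulse_train n m alpha t = if k == j then alpha *: delta_mx i 0 else 0.
Proof.
move=> jn kn tE; have lt : (n - j + k < n.*2.+1)%N by lia.
apply/colP => l; rewrite mxE tE -addnA divnMDl // modnMDl.
rewrite divn_small // modn_small // addn0.
have -> : (n - j + k == n)%N = (k == j) by lia.
by case: (k == j); rewrite ?andbF !mxE // andbT eqxx andbT -val_eqE eq_sym /=;
  case: eqP; rewrite ?mulr1 ?mulr0.
Qed.

(** A single large impulse in a window makes the difference of the two
    predictions exceed what two noises of size [eps] can explain, whatever the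
    state at the start of the window. *)
Lemma impulse_train_separates {R : realType} {n m : nat} (eps : R)
    (S1 S2 : system R n m) :
  0 < sigma_ n (controllability_mx S1) -> S1 <> S2 ->
  \forall alpha \near +oo, forall D : dataset R n m (m * n.*2.+1),
    D.1 = impulse_train n m alpha -> behavior eps S1 D -> ~ behavior eps S2 D.
Proof.
case: n S1 S2 => [|n] S1 S2 sgt neqS.
  (* Without states there is only one system. *)
  case: neqS; case: S1 S2 {sgt} => [A1 B1] [A2 B2].
  by congr pair; apply/matrixP; case.
set F := S1.1 - S2.1; set G := S1.2 - S2.2.
have [r rFG] : exists r, ~ (row r F = 0 /\ row r G = 0).
  apply/existsNP => FG0; apply: neqS; case: S1 S2 @F @G FG0 {sgt}.
  move=> A1 B1 [A2 B2] /= FG0; congr pair; apply/eqP; rewrite -subr_eq0;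
    by apply/eqP/row_matrixP => r; rewrite row0; case: (FG0 r).
have [j [jn [i zji]]] : exists j, (j < n.+2)%N /\
    exists i, input_coef S1.1 S1.2 (row r F) (row r G) j 0 i != 0.
  apply: contrapT => z0; apply: rFG.
  have [|eta0 xiAB] := @input_coef_eq0 _ _ _ S1.1 S1.2 (row r F) (row r G).
    move=> j jn; apply/rowP => i; rewrite [RHS]mxE; apply: contrapT => zji.
    by apply: z0; exists j; split=> //; exists i; apply/eqP.
  by split=> //; exact: left_controllable_eq0 sgt xiAB.
set z := input_coef _ _ _ _ _ _ _ in zji.
have [M M_bound] := @impulse_response_bounded _ _ _ S1.1 S1.2
  (row r F) (row r G) eps (eps + eps) j i jn.
near=> alpha => D DE [w1 D1] [w2 D2].
have alphaM : M < alpha * `|z|.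
  by rewrite -ltr_pdivrMr ?normr_gt0 //; near: alpha;
    apply: nbhs_pinfty_gt; rewrite num_real.
have alpha0 : 0 <= alpha.
  by near: alpha; apply: nbhs_pinfty_ge; rewrite num_real.
(* The window starts j steps before the impulse of block i. *)
pose s := (i * n.+1.*2.+1 + (n.+1 - j))%N.
have sT k : (k < n.+2)%N -> (s + k < m * n.+1.*2.+1)%N.
  move=> kn; rewrite (@leq_trans (i.+1 * n.+1.*2.+1)) //.
    rewrite /s mulSn; lia.
  by rewrite leq_mul2r ltn_ord orbT.
pose T := (m * n.+1.*2.+1)%N.
have [t0 _] : exists t0 : 'I_T, True by exists (Ordinal (sT 0 isT)).
pose tm k : 'I_T := insubd t0 (s + k)%N.
have tmE k : (k < n.+2)%N -> tm k = (s + k)%N :> nat.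
  by move=> /sT kT; rewrite /tm val_insubd kT.
pose x k := D.2 (widen_ord (leqnSn T) (tm k)).
have xS k : (k < n.+1)%N -> x k.+1 = D.2 (lift ord0 (tm k)).
  move=> kn; rewrite /x; congr (D.2 _); apply/val_inj => /=.
  by rewrite /bump /= !tmE // ?ltnS ?(ltnW kn) // addnS.
apply/negP: alphaM; rewrite -leNgt -[alpha]ger0_norm // -normrM.
apply: (M_bound alpha x (fun k => w1 (tm k)) (fun k => D.1 (tm k))).
- by move=> k kn; rewrite xS //; have [_ ->] := D1 (tm k).
- move=> k kn; rewrite DE; apply: impulse_train_window => //.
  by rewrite tmE.
- move=> k l kn; have [w1e _] := D1 (tm k).
  exact: le_trans (normr_le_euclid_norm _ _) w1e.
move=> k kn; rewrite -!row_mul -[row r _ + row r _]raddfD mxE.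
have [w1e x1] := D1 (tm k); have [w2e x2] := D2 (tm k).
have -> : F *m x k + G *m D.1 (tm k) = w2 (tm k) - w1 (tm k).
  apply/eqP; rewrite /F /G !mulmxBl addrACA -opprD subr_eq addrAC.
  rewrite eq_sym subr_eq eq_sym.
  by rewrite [X in _ == X]addrC -x2 x1.
rewrite !mxE (le_trans (ler_normB _ _)) // lerD //.
  exact: le_trans (normr_le_euclid_norm _ _) w2e.
exact: le_trans (normr_le_euclid_norm _ _) w1e.
Unshelve. all: by end_near.
Qed.

(** * Finiteness of bounded uniformly discrete sets *)

(** Pigeonhole: sending x to its cell in the grid of mesh h is injective on X,
    and finitely many cells meet the cube of half-side K. *)
Lemma bounded_separated_finite {T : Type} {R : realType} {I : finType}
    (X : set T) (e : T -> I -> R) (K h : R) :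
  0 < h -> (forall x i, X x -> `|e x i| <= K) ->
  (forall x y, X x -> X y -> (forall i, `|e x i - e y i| < h) -> x = y) ->
  finite_set X.
Proof.
move=> h0 eK sep; pose c x i := Num.truncn ((e x i + K) / h).
pose code x : {ffun I -> 'I_(Num.truncn ((K + K) / h)).+1} :=
  [ffun i => inord (c x i)].
have arg_ge0 x i : X x -> 0 <= (e x i + K) / h.
  move=> Xx; rewrite divr_ge0 ?(ltW h0) // -lerBlDr sub0r.
  by have := eK x i Xx; rewrite ler_norml => /andP[].
have cE x i : X x -> code x i = c x i :> nat.
  move=> Xx; rewrite ffunE inordK // ltnS le_truncn //.
  rewrite ler_wpM2r ?invr_ge0 ?(ltW h0) // lerD2r.
  by have := eK x i Xx; rewrite ler_norml => /andP[].
have code_inj : {in X &, injective code}.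
  move=> x y /set_mem Xx /set_mem Xy xy; apply: sep => // i.
  have cxy : c x i = c y i by rewrite -!cE // xy.
  have /andP[x1 x2] := truncn_itv (arg_ge0 x i Xx).
  have /andP[y1 y2] := truncn_itv (arg_ge0 y i Xy).
  have E : (e x i - e y i) = ((e x i + K) / h - (e y i + K) / h) * h.
    by field; rewrite gt_eqF.
  rewrite E normrM (gtr0_norm h0) -[ltRHS]mul1r ltr_pM2r //.
  move: x1 x2 y1 y2; rewrite -/(c x i) -/(c y i) cxy -!natr1 => x1 x2 y1 y2.
  by rewrite ltr_norml; apply/andP; split; lra.
by rewrite -(eq_finite_set (inj_card_eq code_inj)); exact: finite_finset.
Qed.

(** An infimum of +oo is harmless: it means that two systems of [Spk] are never
    distinct, and any positive gap will do. *)
Lemma uniformly_discrete_gap {R : realType} {n m : nat}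
    (Spk : set (system R n m)) :
  uniformly_discrete Spk ->
  exists2 d : R, 0 < d & forall S1 S2, Spk S1 -> Spk S2 ->
    spectral_norm (row_mx S1.1 S1.2 - row_mx S2.1 S2.2) < d -> S1 = S2.
Proof.
move=> delta_gt0.
have [d d0 d_le] : exists2 d : R, 0 < d & (d%:E <= delta_pk Spk)%E.
  move: delta_gt0; rewrite /uniformly_discrete.
  case: (delta_pk Spk) => [r|_|//].
    by rewrite lte_fin => r0; exists r.
  by exists 1; rewrite ?leey.
exists d => // S1 S2 S1pk S2pk lt_d; apply: contrapT => neqS.
have E : system_norm (S1.1 - S2.1, S1.2 - S2.2) =
    spectral_norm (row_mx S1.1 S1.2 - row_mx S2.1 S2.2).
  by rewrite /system_norm /= opp_row_mx add_row_mx.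
have /ereal_infP/(_ (system_norm (S1.1 - S2.1, S1.2 - S2.2))%:E) := d_le.
rewrite lee_fin leNgt E lt_d => dle; suff : false by []; apply: dle.
exists (spectral_norm (row_mx S1.1 S1.2 - row_mx S2.1 S2.2)) => //; split.
  rewrite -E; exists (S1.1 - S2.1, S1.2 - S2.2) => //.
  by exists S1 => //; exists S2.
move=> /= norm0; apply: neqS.
have /eqP : row_mx S1.1 S1.2 - row_mx S2.1 S2.2 = 0.
  apply/matrixP => i j; rewrite [RHS]mxE; apply/eqP.
  by rewrite -normr_le0 -norm0 normr_le_spectral_norm.
rewrite subr_eq0 => /eqP/eq_row_mx[].
by case: S1 S2 {S1pk S2pk lt_d E norm0} => [A1 B1] [A2 B2] /= -> ->.
Qed.

Lemma bounded_systems_entries {R : realType} {n m : nat}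
    (Spk : set (system R n m)) :
  bounded_systems Spk ->
  exists K : R, forall S i j, Spk S -> `|row_mx S.1 S.2 i j| <= K.
Proof.
move=> /pinfty_ex_gt0[K _ SK]; exists K => S i j /SK /=.
by apply: le_trans; apply: le_trans (normr_le_spectral_norm _ _ _) (ler_norm _).
Qed.

Lemma bounded_discrete_finite {R : realType} {n m : nat}
    (Spk : set (system R n m)) :
  bounded_systems Spk -> uniformly_discrete Spk -> finite_set Spk.
Proof.
move=> /bounded_systems_entries[K SK] /uniformly_discrete_gap[d d0 gap].
pose q := (n * (n + m))%N.
apply: (@bounded_separated_finite _ R ('I_n * 'I_(n + m))%type Spk
  (fun S ij => row_mx S.1 S.2 ij.1 ij.2) K (d / q.+1%:R)).
- by rewrite divr_gt0.
- by move=> S ij; exact: SK.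
move=> S1 S2 S1pk S2pk close; apply: gap => //.
apply: le_lt_trans (spectral_norm_le_sum _) _.
apply: (@le_lt_trans _ _ (\sum_(i < n) \sum_(j < n + m) d / q.+1%:R)).
  apply: ler_sum => i _; apply: ler_sum => j _.
  by rewrite mxE [X in _ + X]mxE ltW //; exact: (close (i, j)).
rewrite !sumr_const !card_ord -mulrnA mulnC -/q -[_ *+ q]mulr_natr mulrAC.
by rewrite ltr_pdivrMr // ltr_pM2l // ltr_nat.
Qed.

(** * Universal inputs for discrete sets *)

(** Finitely many conditions that each hold for all large alpha hold
    simultaneously for some alpha. *)
Lemma uniformly_discrete_enables {R : realType} {n m : nat} (eps : R)
    (Spk : set (system R n m)) :
  bounded_systems Spk -> uniformly_discrete Spk ->
  (forall S, Spk S -> 0 < sigma_ n (controllability_mx S)) ->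
  enables_universal_design eps Spk.
Proof.
move=> Sbnd Sdisc sgt; have Sfin := bounded_discrete_finite Spk Sbnd Sdisc.
pose Y := [set S | (Spk `*` Spk) S /\ S.1 <> S.2].
have /finite_fsetP[X XE] : finite_set Y.
  by apply: sub_finite_set (finite_setX Sfin Sfin) => S [].
pose separates (S : system R n m * system R n m) := [set alpha : R |
  forall D : dataset R n m (m * n.*2.+1), D.1 = impulse_train n m alpha ->
    behavior eps S.1 D -> ~ behavior eps S.2 D].
have : \forall alpha \near +oo, (\bigcap_(S in Y) separates S) alpha.
  rewrite XE; apply: filter_bigI => S SX.
  have [[S1pk S2pk] neqS] : Y S by rewrite XE.
  by apply: impulse_train_separates => //; exact: sgt.
move=> /pinfty_ex_gt0[alpha _ alpha_sep].
exists (m * n.*2.+1)%N, (impulse_train n m alpha) => D [S1 S1pk [S1D DE]].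
exists S1; apply/seteqP; split => [S2 [S2D S2pk]|_ ->//].
apply: contrapT => neqS; apply: (alpha_sep (S1, S2)) S2D => //=.
by split=> //= E; apply: neqS.
Qed.

(** * Indistinguishable trajectories of close systems *)

Definition noiseless_trajectory {R : realType} {n m : nat} (S : system R n m)
    (v : nat -> 'cV[R]_m) : nat -> 'cV[R]_n :=
  fix x t := if t is t'.+1 then S.1 *m x t' + S.2 *m v t' else 0.

(** The bound must be uniform over the systems, because the two close systems
    are chosen after it. *)
Lemma noiseless_trajectory_bounded {R : realType} {n m : nat}
    (v : nat -> 'cV[R]_m) (K U : R) (T : nat) :
  (forall t l, `|v t l 0| <= U) ->
  exists Z : R, forall (S : system R n m) t,
    (forall i j, `|row_mx S.1 S.2 i j| <= K) -> (t <= T)%N ->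
    forall l, `|col_mx (noiseless_trajectory S v t) (v t) l 0| <= Z.
Proof.
move=> vU.
have colZ (S : system R n m) t Z :
    (forall l, `|noiseless_trajectory S v t l 0| <= Z) ->
    forall l, `|col_mx (noiseless_trajectory S v t) (v t) l 0| <= Num.max Z U.
  move=> xZ l; case: (split_ordP l) => k ->.
    by rewrite col_mxEu le_max xZ.
  by rewrite col_mxEd le_max vU orbT.
suff [Z xZ] : exists Z : R, forall (S : system R n m) t,
    (forall i j, `|row_mx S.1 S.2 i j| <= K) -> (t <= T)%N ->
    forall l, `|noiseless_trajectory S v t l 0| <= Z.
  by exists (Num.max Z U) => S t SK tT; apply: colZ; exact: xZ.
elim: T => [|T [Z IHZ]].
  exists 0 => S t _; rewrite leqn0 => /eqP-> l.
  by rewrite mxE normr0.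
exists (Num.max Z ((n + m)%:R * (K * Num.max Z U))) => S t SK.
rewrite leq_eqVlt => /orP[/eqP->|tT] l; rewrite le_max; last by rewrite IHZ.
rewrite /= -mul_row_col normr_mulmx_le ?orbT //.
by apply: colZ => // k; exact: IHZ.
Qed.

(** The difference of two close systems acts on a bounded trajectory like an
    admissible noise. *)
Lemma enables_uniformly_discrete {R : realType} {n m : nat} (eps : R)
    (Spk : set (system R n m)) :
  0 < eps -> bounded_systems Spk -> enables_universal_design eps Spk ->
  uniformly_discrete Spk.
Proof.
move=> eps0 /bounded_systems_entries[K SK] [T [u univ]].
pose v t := if insub t is Some s then u s else 0.
have vE (t : 'I_T) : v t = u t by rewrite /v valK.
have v_le t l : `|v t l 0| <= \sum_s \sum_k `|u s k 0|.
  rewrite /v; case: insubP => [s _ _|_].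
    rewrite (bigD1 s) //= (bigD1 l) //= -addrA lerDl addr_ge0 ?sumr_ge0 //.
    by move=> k _; rewrite sumr_ge0.
  by rewrite mxE normr0 sumr_ge0 // => s _; rewrite sumr_ge0.
have [Z Z_bound] := @noiseless_trajectory_bounded _ n _ v K _ T v_le.
pose Q := (n * (n + m))%:R * Num.max Z 0.
have Q0 : 0 <= Q by rewrite mulr_ge0 // le_max lexx orbT.
(* If F and G have entries below c, then F x(t) + G u(t) has norm at most
   c Q. *)
pose c := eps / (Q + 1).
have Q1 : 0 < Q + 1 by rewrite ltr_wpDl.
have c0 : 0 < c by rewrite divr_gt0.
rewrite /uniformly_discrete ltNge; apply/negP => delta_le0.
have /ereal_inf_ltP[_ [r [[[F G] [S1 S1pk [S2 S2pk [FE GE]]] normE] r0] <-]] :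
    (delta_pk Spk < c%:E)%E by apply: le_lt_trans delta_le0 _; rewrite lte_fin.
rewrite lte_fin -normE => lt_c.
have neqS : S1 <> S2.
  move=> E; apply: r0; rewrite /= -normE -FE -GE E !subrr /system_norm row_mx0.
  exact: spectral_norm0.
pose x := noiseless_trajectory S1 v.
pose D : dataset R n m T := (u, fun t : 'I_T.+1 => x t).
have S1D : behavior eps S1 D.
  exists (fun=> 0) => t; split; last by rewrite /= /bump /= vE addr0.
  apply: le_trans (euclid_norm_le_sum _) _; rewrite big1 ?ltW // => i _.
  by rewrite mxE normr0.
have S2D : behavior eps S2 D.
  exists (fun t => row_mx F G *m col_mx (x t) (v t)) => t; split; last first.
    rewrite /= /bump /= mul_row_col -FE -GE !mulmxBl vE addrACA.
    by rewrite ![_ + (_ - _)]addrC !subrK.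
  apply: le_trans (euclid_norm_le_sum _) _.
  apply: (@le_trans _ _ (\sum_(i < n) (n + m)%:R * (c * Num.max Z 0))).
    apply: ler_sum => i _; apply: normr_mulmx_le => [k l|l].
      by apply: le_trans (normr_le_spectral_norm _ _ _) (ltW lt_c).
    rewrite le_max Z_bound //; last by rewrite ltnW.
    by move=> i' j'; exact: SK.
  rewrite sumr_const card_ord -[_ *+ n]mulr_natl mulrA -natrM mulrCA -/Q /c.
  by rewrite mulrAC ler_pdivrMr // ler_pM2l // lerDl.
have [S SE] : informative eps Spk D by apply: univ; exists S1.
have S1S : (consistent eps D `&` Spk) S1 by [].
have S2S : (consistent eps D `&` Spk) S2 by [].
by apply: neqS; move: S1S S2S; rewrite SE => -> ->.
Qed.

(** * Universal design is equivalent to uniform discreteness *)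

Theorem theorem30 (R : realType) (n m : nat) (eps : R)
    (Spk : set (system R n m))
    (Spk_nonempty : Spk !=set0)
    (eps_gt0 : 0 < eps)
    (Spk_bounded : bounded_systems Spk)
    (gamma_gt0 : (0 < gamma_pk Spk)%E) :
  enables_universal_design eps Spk <-> uniformly_discrete Spk.
Proof.
split; first exact: enables_uniformly_discrete.
move=> Sdisc; apply: uniformly_discrete_enables => // S Spk_S.
rewrite -lte_fin; apply: lt_le_trans gamma_gt0 _.
by apply: ereal_inf_lbound; exists S.
Qed.
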